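(* Let $\Delta>0$ and let RareSync be the protocol with parameter $\Delta$ described in the context. RareSync is a partially synchronous view synchronizer, i.e. in every execution there exists a synchronization time $t_s \ge \mathit{GST}$ (eventual synchronization). Moreover, (1) its communication complexity is $O(n^2)$, and (2) its latency complexity is $O(f)$. Here the constants hidden in $O(\cdot)$ do not depend on $n$, $f$ or the execution, and $\delta$, $\Delta$, $\varepsilon$ are regarded as constants.
   Context: Model. There are $n=3f+1$ processes $P_1,\dots,P_n$ ($f\ge 1$), at most $f$ of them Byzantine (arbitrary behavior); the others are correct. Processes exchange messages over reliable authenticated point-to-point links. Every execution has a time $\mathit{GST}$, unknown to processes, and there is a known $\delta>0$ such that message delays are bounded by $\delta$ after $\mathit{GST}$ (a message sent at time $t$ between correct processes is received by time $\max(t,\mathit{GST})+\delta$). All correct processes start by $\mathit{GST}$. Local clocks may drift arbitrarily before $\mathit{GST}$ and do not drift afterwards. Local steps take zero time; no process takes infinitely many steps in finite time. There is an (ideal, unforgeable) $(2f+1,n)$-threshold signature scheme: $2f+1$ partial signatures of a message $m$ by distinct processes can be combined into one threshold signature of $m$. Received signatures are verified; invalid messages are ignored. RareSync. Views and epochs are positive integers; epoch $e$ consists of $f+1$ views, the $j$-th being $(e-1)(f+1)+j$, $1\le j\le f+1$. Put $\mathit{view\_duration}=\Delta+2\delta+\varepsilon$ with $\varepsilon>0$ a fixed constant, $\mathit{epoch\_duration}=(f+1)\cdot\mathit{view\_duration}$, and $\mathsf{leader}(v)=P_{(v \bmod n)+1}$. Each $P_i$ has variables $\mathit{epoch}_i=1$,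 $\mathit{view}_i=1$, $\mathit{epoch\_sig}_i=\bot$ (initially) and timers $\mathit{view\_timer}_i$, $\mathit{dissemination\_timer}_i$. For a timer, $\mathsf{measure}(x)$ makes it expire after exactly $x$ local-clock time, and $\mathsf{cancel}()$ cancels all pending expirations of that timer. A correct $P_i$ runs the following atomic handlers. (a) On start: $\mathit{view\_timer}_i.\mathsf{measure}(\mathit{view\_duration})$; trigger $\mathsf{advance}(1)$. (b) When $\mathit{view\_timer}_i$ expires: if $\mathit{view}_i<f+1$, set $\mathit{view}_i\leftarrow\mathit{view}_i+1$, call $\mathit{view\_timer}_i.\mathsf{measure}(\mathit{view\_duration})$ and trigger $\mathsf{advance}((\mathit{epoch}_i-1)(f+1)+\mathit{view}_i)$; otherwise broadcast an EPOCH-COMPLETED message for epoch $\mathit{epoch}_i$ carrying $P_i$'s partial signature of $\mathit{epoch}_i$. (c) When, for some $e\ge\mathit{epoch}_i$, EPOCH-COMPLETED messages for $e$ have been received from $2f+1$ processes: combine their partial signatures into $\mathit{epoch\_sig}_i$; set $\mathit{epoch}_i\leftarrow e+1$; cancel both timers; call $\mathit{dissemination\_timer}_i.\mathsf{measure}(\delta)$. (d) On receiving an ENTER-EPOCH message for $e>\mathit{epoch}_i$ with a threshold signature of $e-1$: set $\mathit{epoch\_sig}_i$ to that signature; set $\mathit{epoch}_i\leftarrow e$; cancel both timers; call $\mathit{dissemination\_timer}_i.\mathsf{measure}(\delta)$. (e) When $\mathit{dissemination\_timer}_i$ expires: broadcast an ENTER-EPOCH message for $\mathit{epoch}_i$ carrying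 $\mathit{epoch\_sig}_i$; set $\mathit{view}_i\leftarrow 1$; call $\mathit{view\_timer}_i.\mathsf{measure}(\mathit{view\_duration})$; trigger $\mathsf{advance}((\mathit{epoch}_i-1)(f+1)+1)$. Broadcasting means sending to all $n$ processes. Definitions. A correct process enters view $v$ at time $t$ if it triggers $\mathsf{advance}(v)$ at $t$; it is in view $v$ from that time (included) until its next $\mathsf{advance}(v')$, $v'\ne v$ (excluded), or forever if there is none. Time $t_s$ is a synchronization time if all correct processes are in the same view $v$ from $t_s$ to at least $t_s+\Delta$ and $\mathsf{leader}(v)$ is correct. For an execution $\alpha$, let $t_s(\alpha)$ be the first synchronization time at or after $\mathit{GST}$. A word contains a constant number of signatures and values; each message contains at least one word (each RareSync message is a single word). The communication complexity of $\alpha$ is the number of words sent by all correct processes during $[\mathit{GST},t_s(\alpha)+\Delta]$; the latency complexity of $\alpha$ is $t_s(\alpha)+\Delta-\mathit{GST}$. The communication (latency) complexity of RareSync is the maximum over all its executions. *)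

(* Defs.v *)
(* MathComp / MathComp-Analysis; time is an arbitrary [R : realType]. *)
From HB Require Import structures.
From mathcomp Require Import all_boot all_order all_algebra.
From mathcomp Require Import all_classical all_reals all_analysis.

Set Implicit Arguments.
Unset Strict Implicit.
Unset Printing Implicit Defensive.

Import Order.TTheory GRing.Theory Num.Theory.

Local Open Scope classical_set_scope.
Local Open Scope ring_scope.

Definition nproc (f : nat) : nat := (3 * f).+1.

(* [P_(i+1)] is the ordinal [i]. *)
Definition proc (f : nat) : finType := 'I_(nproc f).

(* [P_((v mod n) + 1)] *)
Definition leader (f v : nat) : proc f :=
  Ordinal (ltn_pmod v (ltn0Sn (3 * f))).

(* Ideal signatures are symbolic terms; what the adversary may put in its
   messages is restricted by [psig_known] and [tsig_known] below.  Only epochs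
   are ever signed. *)
Record psig (f : nat) := PSig { signer : proc f; psigned : nat }.
Record tsig := TSig { tsigned : nat }.

(* The payload of [EnterEpoch] is an [option] because [epoch_sig] may be bottom
   ([None]).  Ill-formed messages of Byzantine processes are represented by
   messages carrying a signature that does not verify. *)
Inductive msg (f : nat) :=
| EpochCompleted (e : nat) (s : psig f)
| EnterEpoch (e : nat) (s : option tsig).

Definition words (f : nat) (m : msg f) : nat := 1.

(* A timer is the list of its pending expirations, each given by the value of
   the local clock at which it is due. *)
Definition timer (R : realType) : Type := seq R.
Definition measure (R : realType) (now x : R) (tm : timer R) : timer R :=
  (now + x) :: tm.
Definition cancel (R : realType) : timer R := [::].

(* [completed e] is the set of processes from which a valid EPOCH-COMPLETED
   message for [e] has been received. *)
Record lstate (R : realType) (f : nat) := LState {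
  started : bool;
  epoch : nat;
  view : nat;
  epoch_sig : option tsig;
  view_timer : timer R;
  dissemination_timer : timer R;
  completed : nat -> {set proc f} }.

Definition init_state (R : realType) (f : nat) : lstate R f :=
  LState false 1 1 None (@cancel R) (@cancel R) (fun _ => finset.set0).

(* [ViewExpire d] and [DisseminationExpire d] are the expiration that was due
   at local time [d]; [Quorum e] is the handler for 2f+1 EPOCH-COMPLETED
   messages for [e]; [Receive j m] is the reception of [m] on the link
   from [j]. *)
Inductive action (R : realType) (f : nat) :=
| Start
| ViewExpire (d : R)
| Quorum (e : nat)
| Receive (j : proc f) (m : msg f)
| DisseminationExpire (d : R).
Arguments Start {R f}.
Arguments ViewExpire {R f} d.
Arguments Quorum {R f} e.
Arguments Receive {R f} j m.
Arguments DisseminationExpire {R f} d.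

Definition enabled (R : realType) (f : nat) (now : R) (s : lstate R f)
    (a : action R f) : bool :=
  match a with
  | Start => ~~ started s
  | ViewExpire d => [&& started s, d \in view_timer s & d <= now]
  | Quorum e => [&& started s, (epoch s <= e)%N
                  & (2 * f + 1 <= #|completed s e|)%N]
  | Receive _ _ => started s
  | DisseminationExpire d =>
      [&& started s, d \in dissemination_timer s & d <= now]
  end.

(* Local actions, which a process performs without delay once enabled. *)
Definition urgent (R : realType) (f : nat) (a : action R f) : bool :=
  match a with
  | ViewExpire _ | Quorum _ | DisseminationExpire _ => true
  | Start | Receive _ _ => false
  end.

Record effect (R : realType) (f : nat) := Effect {
  new_state : lstate R f;
  advances : option nat;
  broadcasts : option (msg f) }.

Section RareSync.
Context (R : realType) (delta Delta eps : R) (f : nat).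

Definition view_duration : R := Delta + 2 * delta + eps.

Definition global_view (e j : nat) : nat := (e.-1 * f.+1 + j)%N.

Definition new_epoch (now : R) (s : lstate R f) (e : nat) (sg : tsig) :
    lstate R f :=
  LState (started s) e (view s) (Some sg)
    (@cancel R) (measure now delta (@cancel R)) (completed s).

(* The atomic handler of process [i] for an action performed when its local
   clock shows [now]. *)
Definition handle (i : proc f) (now : R) (s : lstate R f) (a : action R f) :
    effect R f :=
  match a with
  | Start =>
      Effect (LState true (epoch s) (view s) (epoch_sig s)
                (measure now view_duration (view_timer s))
                (dissemination_timer s) (completed s))
        (Some 1%N) None
  | ViewExpire d =>
      let vt := rem d (view_timer s) in
      if (view s < f.+1)%N then
        Effect (LState (started s) (epoch s) (view s).+1 (epoch_sig s)
                  (measure now view_duration vt)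
                  (dissemination_timer s) (completed s))
          (Some (global_view (epoch s) (view s).+1)) None
      else
        Effect (LState (started s) (epoch s) (view s) (epoch_sig s)
                  vt (dissemination_timer s) (completed s))
          None (Some (EpochCompleted (epoch s) (PSig i (epoch s))))
  | Quorum e => Effect (new_epoch now s e.+1 (TSig e)) None None
  | Receive j (EpochCompleted e sg) =>
      if (signer sg == j) && (psigned sg == e) then
        Effect (LState (started s) (epoch s) (view s) (epoch_sig s)
                  (view_timer s) (dissemination_timer s)
                  (fun e' => if e' == e then (j |: completed s e')%SET
                             else completed s e'))
          None None
      else Effect s None None
  | Receive j (EnterEpoch e (Some sg)) =>
      if (epoch s < e)%N && ((tsigned sg).+1 == e) then
        Effect (new_epoch now s e sg) None None
      else Effect s None None
  | Receive j (EnterEpoch e None) => Effect s None None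
  | DisseminationExpire d =>
      Effect (LState (started s) (epoch s) 1 (epoch_sig s)
                (measure now view_duration (view_timer s))
                (rem d (dissemination_timer s)) (completed s))
        (Some (global_view (epoch s) 1))
        (Some (EnterEpoch f (epoch s) (epoch_sig s)))
  end.

(* The steps of all correct processes, listed in an order compatible with time
   and causality; simultaneous steps may be listed in any such order.  [None]
   is a step with no effect on correct processes, e.g. a Byzantine step. *)
Record trace := Trace {
  correct : {set proc f};
  GST : R;
  clock : proc f -> R -> R;
  time : nat -> R;
  event : nat -> option (proc f * action R f) }.

(* Local states just before step [k]. *)
Fixpoint state (al : trace) (k : nat) (i : proc f) : lstate R f :=
  match k with
  | 0 => init_state R f
  | k'.+1 =>
      match event al k' with
      | Some (j, a) =>
          if i == j
          then new_state (handle i (clock al i (time al k')) (state al k' i) a)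
          else state al k' i
      | None => state al k' i
      end
  end.

Definition step_effect (al : trace) (k : nat) (i : proc f) (a : action R f) :
    effect R f :=
  handle i (clock al i (time al k)) (state al k i) a.

Definition sends (al : trace) (k : nat) (i : proc f) (m : msg f) : Prop :=
  exists a, event al k = Some (i, a) /\
            broadcasts (step_effect al k i a) = Some m.

Definition enters (al : trace) (k : nat) (i : proc f) (v : nat) : Prop :=
  exists a, event al k = Some (i, a) /\
            advances (step_effect al k i a) = Some v.

(* Signatures that Byzantine processes can put in a message received at step
   [k]: their own partial signatures, those carried by earlier messages of
   correct processes, and what can be combined from them.  Correct processes
   only broadcast, and a message to a Byzantine process may arrive at once, so
   every earlier message of a correct process may be known. *)
Definition psig_known (al : trace) (k : nat) (s : psig f) : Prop :=
  signer s \notin correct al \/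
  exists k' j e, [/\ (k' < k)%N, j \in correct al &
                     sends al k' j (EpochCompleted e s)].

Definition tsig_known (al : trace) (k : nat) (s : tsig) : Prop :=
  (exists Q : {set proc f}, (2 * f + 1 <= #|Q|)%N /\
     forall i, i \in Q -> psig_known al k (PSig i (tsigned s))) \/
  exists k' j e, [/\ (k' < k)%N, j \in correct al &
                     sends al k' j (EnterEpoch f e (Some s))].

Definition byzantine_can_send (al : trace) (k : nat) (m : msg f) : Prop :=
  match m with
  | EpochCompleted _ s => psig_known al k s
  | EnterEpoch _ (Some s) => tsig_known al k s
  | EnterEpoch _ None => True
  end.

Record execution (al : trace) : Prop := Execution {
  few_byzantine : (#|~: correct al|%SET <= f)%N;

  (* Clocks need not be continuous or strictly increasing before GST; a timer
     expires at the first instant at which the clock has advanced by the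
     requested amount. *)
  clock_monotone : forall i, i \in correct al ->
    {homo clock al i : s t / s <= t};
  clock_no_drift : forall i s t, i \in correct al ->
    GST al <= s -> s <= t -> clock al i t - clock al i s = t - s;

  time_monotone : {homo time al : k l / (k <= l)%N >-> k <= l};
  (* No process takes infinitely many steps in finite time. *)
  time_unbounded : forall t, exists k, t < time al k;

  step_enabled : forall k i a, event al k = Some (i, a) ->
    i \in correct al /\
    enabled (clock al i (time al k)) (state al k i) a;
  starts_by_GST : forall i, i \in correct al ->
    exists k, event al k = Some (i, Start) /\ time al k <= GST al;

  (* Local steps take zero time: no real time elapses while one is enabled.
     [state al k.+1] is the state during [[time al k, time al k.+1[]. *)
  urgency : forall k t i a, i \in correct al -> urgent a ->
    time al k <= t -> t < time al k.+1 ->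
    ~~ enabled (clock al i t) (state al k.+1 i) a;

  links_authenticated : forall k i j m,
    event al k = Some (i, Receive j m) ->
    if j \in correct al then exists k', (k' < k)%N /\ sends al k' j m
    else byzantine_can_send al k m;
  links_reliable : forall k i j m, i \in correct al -> j \in correct al ->
    sends al k j m ->
    exists k', [/\ (k < k')%N, event al k' = Some (i, Receive j m) &
                   time al k' <= Num.max (time al k) (GST al) + delta] }.

Definition in_view (al : trace) (i : proc f) (v : nat) (t : R) : Prop :=
  exists k, [/\ enters al k i v, time al k <= t &
    forall k' v', (k < k')%N -> enters al k' i v' -> v' <> v ->
      t < time al k'].

Definition synchronization_time (al : trace) (ts : R) : Prop :=
  exists v, leader f v \in correct al /\
    forall i t, i \in correct al -> ts <= t -> t <= ts + Delta ->
      in_view al i v t.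

Definition is_first_sync_time (al : trace) (ts : R) : Prop :=
  [/\ GST al <= ts, synchronization_time al ts &
      forall t, GST al <= t -> synchronization_time al t -> ts <= t].

(* The default value of [xget] is only relevant if there is no such time. *)
Definition first_sync_time (al : trace) : R :=
  xget (GST al) (is_first_sync_time al).

(* A broadcast sends its message to each of the [n] processes. *)
Definition step_words (al : trace) (k : nat) : nat :=
  match event al k with
  | Some (i, a) =>
      match broadcasts (step_effect al k i a) with
      | Some m => nproc f * words m
      | None => 0
      end
  | None => 0
  end.

Definition exec_communication (al : trace) : \bar R :=
  (\sum_(0 <= k <oo |
        (GST al <= time al k <= first_sync_time al + Delta)%R)
     (step_words al k)%:R%:E)%E.

Definition exec_latency (al : trace) : \bar R :=
  (first_sync_time al + Delta - GST al)%:E.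

Definition communication_complexity : \bar R :=
  ereal_sup [set exec_communication al | al in execution].

Definition latency_complexity : \bar R :=
  ereal_sup [set exec_latency al | al in execution].

End RareSync.

(* Main.v *)
(* Let [e] be the highest epoch of a correct process at GST.  Entering an epoch
   is announced to all, so by GST + 2 delta every correct process is at least in
   [e]; unless one has moved on, all complete [e] by about one epoch duration
   later and form a quorum.  Hence the first entry into [e.+1] happens at some
   [ts] with GST <= ts <= GST + O(f).  Leaving an epoch takes the completion
   of a correct process that entered it, so nobody leaves [e.+1] before
   [ts + f.+1 * view_duration], while all enter it by [ts + 2 delta].  In that
   epoch, all timers run exactly and the views of the correct processes overlap
   for more than [Delta]; one of the [f.+1] leaders is correct.
   For the communication, two broadcasts of the same kind by one process are at
   least [delta] apart and in different epochs: each process broadcasts at most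
   3 times per kind below epoch [e], since it reaches [e] by GST + 2 delta, and
   at most twice per kind in the epochs [e] and [e.+1]. *)
Require Import Defs.
From mathcomp Require Import all_boot all_order all_algebra.
From mathcomp Require Import all_classical all_reals all_analysis.
From mathcomp Require Import lra zify.

Set Implicit Arguments.
Unset Strict Implicit.
Unset Printing Implicit Defensive.

Import Order.TTheory GRing.Theory Num.Theory.

Local Open Scope ring_scope.

Section Execution.
Context (R : realType) (delta Delta eps : R) (f : nat) (al : trace R f).
Context (delta_gt0 : 0 < delta) (Delta_gt0 : 0 < Delta) (eps_gt0 : 0 < eps).
Context (ex : execution delta Delta eps al).

Local Notation vd := (view_duration delta Delta eps).
Local Notation st := (state delta Delta eps al).
Local Notation G := (GST al).
Local Notation tm := (time al).
Local Notation ck := (clock al).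
Local Notation sends := (sends delta Delta eps al).
Local Notation enters := (enters delta Delta eps al).
Local Notation step := (step_effect delta Delta eps al).

(** * Durations, and clocks after GST *)

Lemma vd_gt : 2 * delta + Delta < vd.
Proof. by have := eps_gt0; rewrite /view_duration; lra. Qed.

Lemma vd_gt0 : 0 < vd.
Proof. by move: vd_gt delta_gt0 Delta_gt0; lra. Qed.

(* The real time at which the clock of [i] shows [d], if that is after GST. *)
Definition due (i : proc f) (d : R) : R := G + (d - ck i G).

Lemma le_clock i d t : i \in correct al -> G <= t ->
  (d <= ck i t) = (due i d <= t).
Proof.
move=> ic Gt; have := clock_no_drift ex ic (lexx G) Gt.
by rewrite /due => h; apply/idP/idP; lra.
Qed.

Lemma due_clock i t x : i \in correct al -> G <= t -> due i (ck i t + x) = t + x.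
Proof.
move=> ic Gt; have := clock_no_drift ex ic (lexx G) Gt.
by rewrite /due; lra.
Qed.

(** The clock shows no more at [t] than at [u], so a timer started at [t], even before GST, expires
    no later than the same timer started at [u]. *)
Lemma due_clock_le i t u x : i \in correct al -> t <= u -> G <= u ->
  due i (ck i t + x) <= u + x.
Proof.
move=> ic tu Gu; rewrite -(due_clock x ic Gu) /due.
by have := clock_monotone ex ic tu; lra.
Qed.

(** * Elementary invariants of local states *)

Lemma stateP k i :
  st k.+1 i = st k i \/
  exists a, [/\ i \in correct al, event al k = Some (i, a),
    enabled (ck i (tm k)) (st k i) a & st k.+1 i = new_state (step k i a)].
Proof.
rewrite /=; case E: (event al k) => [[j a]|]; last by left.
case: eqP => [->|_]; last by left.
by right; exists a; have [? ?] := step_enabled ex E.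
Qed.

Lemma state_step k i a : event al k = Some (i, a) ->
  st k.+1 i = new_state (step k i a).
Proof. by move=> E; rewrite /= E eqxx. Qed.

Lemma not_started k i : ~~ started (st k i) -> st k i = init_state R f.
Proof.
elim: k => // k IH; have [->//|[a [_ _ en ->]]] := stateP k i.
move: en; rewrite /step_effect; case: a => [|d|e|j [e s|e [s|]]|d] /=.
- by [].
- by case/andP => + _; case: ifP => _ /= ->.
- by case/andP => ->.
- by move=> st; case: ifP => _ /=; rewrite st.
- by move=> st; case: ifP => _ /=; rewrite st.
- by move=> ->.
- by case/andP => ->.
Qed.

Lemma started_step k i : started (st k i) -> started (st k.+1 i).
Proof.
have [->//|[a [_ _ _ ->]]] := stateP k i.
rewrite /step_effect; case: a => [|d|e|j [e s|e [s|]]|d] //=.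
- by case: ifP.
- by case: ifP.
- by case: ifP.
Qed.

Lemma started_mono k l i : (k <= l)%N -> started (st k i) -> started (st l i).
Proof.
by move=> /subnK <-; elim: (l - k)%N => //= n IH sk; apply: started_step (IH sk).
Qed.

Lemma epoch_step k i : (epoch (st k i) <= epoch (st k.+1 i))%N.
Proof.
have [->//|[a [_ _ + ->]]] := stateP k i.
rewrite /step_effect; case: a => [|d|e|j [e s|e [s|]]|d] //=.
- by case: ifP.
- by case/and3P => _ /leqW.
- by case: ifP.
- by case: ifP => //= /andP[/ltnW].
Qed.

Lemma epoch_mono k l i : (k <= l)%N -> (epoch (st k i) <= epoch (st l i))%N.
Proof.
by move=> /subnK <-; elim: (l - k)%N => // n IH; apply: leq_trans IH (epoch_step _ _).
Qed.

Lemma epoch_gt0 k i : (0 < epoch (st k i))%N.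
Proof. exact: leq_trans (epoch_mono i (leq0n k)). Qed.

Lemma epoch_ltn k l i : (epoch (st k i) < epoch (st l i))%N -> (k < l)%N.
Proof. by apply: contraTT; rewrite -!leqNgt; apply: epoch_mono. Qed.

Lemma epoch_sigP k i : (1 < epoch (st k i))%N ->
  epoch_sig (st k i) = Some (TSig (epoch (st k i)).-1).
Proof.
elim: k => // k IH; have [->//|[a [_ _ + ->]]] := stateP k i.
rewrite /step_effect; case: a => [|d|e|j [e s|e [[s]|]]|d] //=.
- by case: ifP.
- by case: ifP.
- by case: ifP => //= /andP[_ /eqP <-].
Qed.

(** * Pending expirations, and the state at a given real time *)

Definition pending (s : lstate R f) : seq R :=
  view_timer s ++ dissemination_timer s.

Lemma pending_step k i d : d \in pending (st k.+1 i) ->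
  d \in pending (st k i) \/
  exists2 x, 0 < x & d = ck i (tm k) + x.
Proof.
have vd0 := vd_gt0.
have [->|[a [_ _ _ ->]]] := stateP k i; first by left.
rewrite /step_effect /pending !mem_cat.
case: a => [|d'|e|j [e s|e [s|]]|d'] //=.
- rewrite inE -orbA => /orP[/eqP->|]; last by left.
  by right; exists vd.
- case: ifP => _ /=; rewrite ?inE -?orbA.
    case/or3P => [/eqP->|/mem_rem|]; first by right; exists vd.
      by move=> ->; left.
    by move=> ->; left; rewrite orbT.
  by case/orP => [/mem_rem|] ->; left; rewrite ?orbT.
- by rewrite inE => /eqP ->; right; exists delta.
- by case: ifP; left.
- by case: ifP => _ /=; [rewrite inE => /eqP ->; right; exists delta|left].
- by left.
- rewrite inE -orbA; case/or3P => [/eqP->|->|/mem_rem ->].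
  + by right; exists vd.
  + by left.
  + by left; rewrite orbT.
Qed.

Lemma pending_not_due k i d t : i \in correct al ->
  d \in pending (st k.+1 i) -> tm k <= t -> t < tm k.+1 -> ck i t < d.
Proof.
move=> ic dp kt tk; rewrite ltNge; apply/negP => dt.
have sk : started (st k.+1 i).
  by apply: contraLR dp => /not_started ->.
move: dp; rewrite mem_cat => /orP[dv|dd].
- have := urgency ex (a := ViewExpire d) ic isT kt tk.
  by rewrite [enabled _ _ _]/= -/(st k.+1 i) sk dv dt.
- have := urgency ex (a := DisseminationExpire d) ic isT kt tk.
  by rewrite [enabled _ _ _]/= -/(st k.+1 i) sk dd dt.
Qed.

(* The restriction to [G <= u] is needed because a clock may jump past [d]
   before GST. *)
Lemma pending_due k i d u : i \in correct al -> d \in pending (st k i) ->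
  G <= u -> due i d <= u -> tm k <= u.
Proof.
move=> ic; elim: k d u => [|k IH] d u //= dp Gu du.
rewrite leNgt; apply/negP => uk.
case: (leP (tm k) u) => ku.
  have := pending_not_due ic dp ku uk.
  by rewrite ltNge le_clock // du.
case: (pending_step dp) => [dk|[x x0 dE]].
  by have := IH _ _ dk Gu du; rewrite leNgt ku.
by move: du; rewrite dE due_clock //; lra.
Qed.

(* The number of steps up to time [t], so that [st (idx t) i] is the state of
   [i] once all steps at time [t] are done. *)
Definition idx (t : R) : nat := ex_minn (time_unbounded ex t).

Lemma ltn_idx k t : (k < idx t)%N = (tm k <= t).
Proof.
rewrite /idx; case: ex_minnP => m tm_m min_m.
rewrite leNgt ltnNge; congr (~~ _); apply/idP/idP => [mk|/min_m//].
exact: lt_le_trans tm_m (time_monotone ex mk).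
Qed.

Lemma idx_mono t u : t <= u -> (idx t <= idx u)%N.
Proof.
move=> tu; rewrite leqNgt; apply/negP; rewrite ltn_idx => h.
by have := ltnn (idx u); rewrite ltn_idx (le_trans h tu).
Qed.

Lemma idx_gt t : t < tm (idx t).
Proof. by rewrite ltNge -ltn_idx ltnn. Qed.

Lemma pending_idx i d t : i \in correct al -> G <= t ->
  d \in pending (st (idx t) i) -> t < due i d.
Proof.
move=> ic Gt dp; rewrite ltNge; apply/negP => dt.
by have := pending_due ic dp Gt dt; rewrite leNgt idx_gt.
Qed.

Lemma started_idx i t : i \in correct al -> G <= t -> started (st (idx t) i).
Proof.
move=> ic Gt; have [k [E kG]] := starts_by_GST ex ic.
apply: (@started_mono k.+1); last by rewrite (state_step E).
by rewrite ltn_idx (le_trans kG).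
Qed.

(** [urgency] speaks of the state after some step; the start by GST provides one, so [idx t] has a
    predecessor. *)
Lemma quiescent i t a : i \in correct al -> G <= t -> urgent a ->
  ~~ enabled (ck i t) (st (idx t) i) a.
Proof.
move=> ic Gt ua; have [k [_ kG]] := starts_by_GST ex ic.
have : (k < idx t)%N by rewrite ltn_idx (le_trans kG).
case E: (idx t) => [//|m] _; apply: (urgency ex ic ua).
  by rewrite -ltn_idx E.
by rewrite -E idx_gt.
Qed.


(** * Delays measured from a step *)

(* [t] is [x] later than [t0], or than GST if [t0] precedes GST, in which case
   only the upper bound is claimed. *)
Definition after (t0 x t : R) : Prop :=
  (forall u, t0 <= u -> G <= u -> t <= u + x) /\ (G <= t0 -> t0 + x <= t).

Lemma after_refl t : after t 0 t.
Proof. by split=> [u|]; rewrite addr0. Qed.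

(** Urgency gives the upper bound; for the lower one, the clock must already show [d] when the
    handler runs. *)
Lemma after_expire i k t0 x d : i \in correct al -> t0 <= tm k -> 0 <= x ->
  d \in pending (st k i) -> d <= ck i (tm k) ->
  after t0 x (due i d) -> after t0 x (tm k).
Proof.
move=> ic t0k x0 dp dk [up lo]; split=> [u t0u Gu|Gt0].
  by apply: (pending_due ic dp) (up u t0u Gu); lra.
by rewrite (le_trans (lo Gt0)) // -le_clock // (le_trans Gt0).
Qed.

Lemma after_measure i k t0 x y : i \in correct al -> 0 <= x ->
  after t0 x (tm k) -> after t0 (x + y) (due i (ck i (tm k) + y)).
Proof.
move=> ic x0 [up lo]; split=> [u t0u Gu|Gt0].
  by rewrite addrA; apply: due_clock_le => //; [exact: up|lra].
by rewrite due_clock // ?addrA ?lerD2r ?lo //; have := lo Gt0; lra.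
Qed.

(** * Phases of a process within an epoch *)

Definition is_entry (a : action R f) : bool :=
  match a with Start | DisseminationExpire _ => true | _ => false end.

(** Both kinds of entry leave the epoch unchanged, so it can be read off the state before step
    [k]. *)
Definition entry (k : nat) (i : proc f) (e : nat) : Prop :=
  epoch (st k i) = e /\ exists2 a, event al k = Some (i, a) & is_entry a.

(** The process entered its current epoch at step [k0] and has not left it. All delays refer to that
    single entry, so errors do not accumulate over the views. In [active_timer], either a view is
    being timed or the completion has been broadcast. *)
Record active (k k0 : nat) (i : proc f) (s : lstate R f) : Prop := Active {
  active_lt : (k0 < k)%N;
  active_entry : entry k0 i (epoch s);
  active_dissemination : dissemination_timer s = [::];
  active_view : (0 < view s <= f.+1)%N;
  active_enters : forall j, (0 < j <= view s)%N ->
    exists k', [/\ (k0 <= k')%N, (k' < k)%N,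
      enters k' i (global_view f (epoch s) j) &
      after (tm k0) (j.-1%:R * vd) (tm k')];
  active_timer :
    (exists2 d, view_timer s = [:: d] &
       after (tm k0) ((view s)%:R * vd) (due i d)) \/
    [/\ view_timer s = [::], view s = f.+1 & exists k', [/\ (k' < k)%N,
       sends k' i (EpochCompleted (epoch s) (PSig i (epoch s))) &
       after (tm k0) (f.+1%:R * vd) (tm k')]] }.

(** In [Disseminating], [k0] is the step that raised the epoch and started the timer; in [Running],
    it is the step of the entry. *)
Variant phase (k : nat) (i : proc f) (s : lstate R f) : Prop :=
| Idle of ~~ started s
| Disseminating k0 d of (epoch (st k0 i) < epoch s)%N &
    epoch (st k0.+1 i) = epoch s & view_timer s = [::] &
    dissemination_timer s = [:: d] & after (tm k0) delta (due i d)
| Running k0 of active k k0 i s.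

Lemma phaseS k i s : phase k i s -> phase k.+1 i s.
Proof.
case=> [?|k0 d *|k0 [lt en dt vw ents tim]]; first exact: Idle.
  exact: (@Disseminating _ _ _ k0 d).
apply: (@Running _ _ _ k0); split=> //; first exact: ltnW.
  by move=> j /ents[k' [? ? ? ?]]; exists k'; split=> //; exact: ltnW.
case: tim => [|[vt vE [k' [? ? ?]]]]; first by left.
by right; split=> //; exists k'; split=> //; exact: ltnW.
Qed.

Lemma phase_completed k i s c : phase k i s ->
  phase k i (LState (started s) (epoch s) (view s) (epoch_sig s)
               (view_timer s) (dissemination_timer s) c).
Proof.
case=> [?|k0 d *|k0 []]; first exact: Idle.
  exact: (@Disseminating _ _ _ k0 d).
by move=> *; apply: (@Running _ _ _ k0); split.
Qed.

Lemma phase_new_epoch k i e sg a : i \in correct al -> event al k = Some (i, a) ->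
  (epoch (st k i) < e)%N ->
  new_state (step k i a) = new_epoch delta (ck i (tm k)) (st k i) e sg ->
  phase k.+1 i (new_epoch delta (ck i (tm k)) (st k i) e sg).
Proof.
move=> ic E lt_e sE; apply: (@Disseminating _ _ _ k (ck i (tm k) + delta)) => //.
  by rewrite (state_step E) sE.
by have := @after_measure i k (tm k) 0 delta ic (lexx _) (after_refl _); rewrite add0r.
Qed.

Lemma phase_entry k i a sg : i \in correct al -> event al k = Some (i, a) ->
  is_entry a -> advances (step k i a) = Some (global_view f (epoch (st k i)) 1) ->
  phase k.+1 i (LState true (epoch (st k i)) 1 sg
    [:: ck i (tm k) + vd] [::] (completed (st k i))).
Proof.
move=> ic E en ad; apply: (@Running _ _ _ k); split=> //=.
- by split=> //; exists a.
- move=> j; case: j => [//|[|//]] _; exists k; split=> //.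
    by exists a.
  by rewrite mul0r; apply: after_refl.
- left; exists (ck i (tm k) + vd) => //.
  have := @after_measure i k (tm k) 0 vd ic (lexx _) (after_refl _).
  by rewrite add0r mul1r.
Qed.

(** The timer of the [j]-th view expires [j] view durations after the entry; it is then restarted
    for the next view or, in the last one, gives way to the completion broadcast. *)
Lemma phase_view_expire k i d k0 : i \in correct al ->
  event al k = Some (i, ViewExpire d) -> active k k0 i (st k i) ->
  started (st k i) -> d \in view_timer (st k i) -> d <= ck i (tm k) ->
  phase k.+1 i (new_state (step k i (ViewExpire d))).
Proof.
move=> ic E [lt en dt /andP[v0 vf] ents tim] sk dv dk.
have vd0 := vd_gt0.
have [d' vE aft] : exists2 d', view_timer (st k i) = [:: d'] &
    after (tm k0) ((view (st k i))%:R * vd) (due i d').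
  by case: tim => // -[v0' _ _]; rewrite v0' in dv.
have dd' : d = d' by apply/eqP; move: dv; rewrite vE inE.
rewrite -{}dd' in vE aft.
have dp : d \in pending (st k i) by rewrite mem_cat dv.
have x0 : 0 <= (view (st k i))%:R * vd by rewrite mulr_ge0 // ltW.
have aftk := after_expire ic (time_monotone ex (ltnW lt)) x0 dp dk aft.
rewrite {1}/step_effect /=.
case: ltnP => vf' /=; apply: (@Running _ _ _ k0); split=> //=.
- exact: ltnW.
- move=> j /andP[j0]; rewrite leq_eqVlt => /orP[/eqP->|].
    exists k; split=> //; first exact: ltnW.
    by exists (ViewExpire d); rewrite /step_effect /= vf'.
  rewrite ltnS => jv; have [|k' [? ? ? ?]] := ents j; first by rewrite j0.
  by exists k'; split=> //; exact: ltnW.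
- left; exists (ck i (tm k) + vd); first by rewrite vE /= eqxx.
  by have := @after_measure i k _ _ vd ic x0 aftk; rewrite mulrSr mulrDl mul1r.
- exact: ltnW.
- by rewrite v0.
- move=> j jv; have [k' [? ? ? ?]] := ents j jv.
  by exists k'; split=> //; exact: ltnW.
- have vfE : view (st k i) = f.+1 by apply/eqP; rewrite eqn_leq vf' vf.
  right; split=> //; first by rewrite vE /= eqxx.
  exists k; split=> //; last by rewrite -vfE.
  by exists (ViewExpire d); rewrite /step_effect /= ltnNge vf'.
Qed.

(** Induction on steps. In each phase of a started process at most one timer has a pending
    expiration, so an expiration reveals the phase in which it occurs. *)
Lemma state_phase k i : i \in correct al -> phase k i (st k i).
Proof.
move=> ic; elim: k => [|k IH]; first exact: Idle.
have [->|[a [_ E en ->]]] := stateP k i; first exact: phaseS.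
case: a E en => [|d|e|j [e s|e [s|]]|d] E en; rewrite /step_effect.
- have /not_started sE : ~~ started (st k i) by [].
  have := @phase_entry k i Start None ic E isT.
  by rewrite /= /step_effect /= sE; apply.
- have /and3P[sk dv dk] := en.
  case: IH => [|k0 d' _ _ vt|k0 act]; first by rewrite sk.
    by rewrite vt in dv.
  exact: (phase_view_expire ic E act).
- by have /and3P[_ ek _] := en; apply: (phase_new_epoch ic E).
- rewrite /=; case: ifP => _ /=; last exact: phaseS.
  exact/phase_completed/phaseS.
- have := phase_new_epoch (e := e) (sg := s) ic E.
  rewrite /step_effect /=; case: ifP => [/andP[lt _]|_ _] /=; last exact: phaseS.
  by apply.
- exact: phaseS.
- have /and3P[sk dd dk] := en.
  case: IH => [|k0 d' _ _ vt dt _|k0 act]; first by rewrite sk.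
    have := @phase_entry k i _ (epoch_sig (st k i)) ic E isT.
    have dd' : d = d' by apply/eqP; move: dd; rewrite dt inE.
    by rewrite /= /step_effect /= sk vt dt dd' /= eqxx; apply.
  by rewrite (active_dissemination act) in dd.
Qed.

(** * Completions and entries of correct processes *)

Lemma sends_completed k i e s : sends k i (EpochCompleted e s) ->
  [/\ epoch (st k i) = e, s = PSig i e &
      exists d, [/\ event al k = Some (i, ViewExpire d), d \in view_timer (st k i),
        d <= ck i (tm k) & (f.+1 <= view (st k i))%N]].
Proof.
case=> a [E]; have [_] := step_enabled ex E.
rewrite /step_effect; case: a E => [|d|e'|j [e' s'|e' [s'|]]|d] E //=.
- case: ltnP => // vf /and3P[_ dv dk] /= [<- <-]; split=> //.
  by exists d.
- by case: ifP.
- by case: ifP.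
Qed.

Lemma sends_enter k i e s : sends k i (EnterEpoch f e s) ->
  [/\ epoch (st k i) = e, s = epoch_sig (st k i) &
      exists d, event al k = Some (i, DisseminationExpire d)].
Proof.
case=> a [E]; rewrite /step_effect.
case: a E => [|d|e'|j [e' s'|e' [s'|]]|d] E //=.
- by case: ifP.
- by case: ifP.
- by case: ifP.
- by case=> <- <-; split=> //; exists d.
Qed.

(** Serves to trace a threshold signature replayed by a Byzantine process back to the epoch of the
    correct process that sent it. *)
Lemma epoch_sig_epoch k i s : epoch_sig (st k i) = Some s ->
  epoch (st k i) = (tsigned s).+1.
Proof.
elim: k => // k IH; have [->//|[a [_ _ _ ->]]] := stateP k i.
rewrite /step_effect; case: a => [|d|e|j [e s'|e [s'|]]|d] //=.
- by case: ifP.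
- by case=> <-.
- by case: ifP.
- by case: ifP => //= /andP[_ /eqP <-] [<-].
Qed.

Lemma completion_active k i e s : sends k i (EpochCompleted e s) ->
  exists2 k0, active k k0 i (st k i) & after (tm k0) (f.+1%:R * vd) (tm k).
Proof.
move=> /sends_completed[_ _ [d [E dv dk vf]]].
have [ic /and3P[sk _ _]] := step_enabled ex E.
case: (state_phase k ic) => [|k0 d' _ _ vt|k0 act]; first by rewrite sk.
  by rewrite vt in dv.
exists k0 => //; have [lt _ _ vw _ tim] := act.
have vE : view (st k i) = f.+1 by apply/eqP; rewrite eqn_leq vf; case/andP: vw => _ ->.
rewrite vE in tim; case: tim => [[d' vt aft]|[vt _ _]]; last by rewrite vt in dv.
have dd' : d = d' by apply/eqP; move: dv; rewrite vt inE.
apply: (after_expire ic (time_monotone ex (ltnW lt)) _ _ dk).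
- by rewrite mulr_ge0 // ltW // vd_gt0.
- by rewrite mem_cat dv.
- by rewrite dd'.
Qed.

Lemma completion_entry k i e s : sends k i (EpochCompleted e s) ->
  exists k0, [/\ (k0 < k)%N, entry k0 i e & after (tm k0) (f.+1%:R * vd) (tm k)].
Proof.
move=> se; have [k0 act aft] := completion_active se.
have [<- _ _] := sends_completed se.
by exists k0; split=> //; [exact: active_lt act|exact: active_entry act].
Qed.

(** Beyond epoch 1 an entry is a dissemination, since a process starts in epoch 1. *)
Lemma entry_sends k i e : entry k i e -> (1 < e)%N ->
  sends k i (EnterEpoch f e (Some (TSig e.-1))).
Proof.
move=> [ek [a E ea]] e1; exists a; split=> //; rewrite /step_effect.
case: a E ea => // [|d] E _ /=.
  have [_ en] := step_enabled ex E.
  by move: ek e1; rewrite (not_started en) => <-.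
by rewrite epoch_sigP ek.
Qed.

Lemma entry_correct k i e : entry k i e -> i \in correct al.
Proof. by case=> _ [a E _]; case: (step_enabled ex E). Qed.

(** Only raising the epoch restarts the dissemination timer. Hence each epoch is entered at most
    once. *)
Lemma entry_after k0 k i e : entry k0 i e -> (k0 < k)%N ->
  started (st k i) /\ (dissemination_timer (st k i) = [::] \/ (e < epoch (st k i))%N).
Proof.
move=> en; have ic := entry_correct en; have [ek0 [a0 E0 ea0]] := en.
elim: k => // k IH; rewrite ltnS leq_eqVlt => /orP[/eqP kE|lt].
  subst k; rewrite (state_step E0) /step_effect.
  case: a0 E0 ea0 => // [|d] E0 _ /=.
    by have [_ /not_started ->] := step_enabled ex E0; split=> //; left.
  have [_ /and3P[sk dd _]] := step_enabled ex E0; split=> //.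
  case: (state_phase k0 ic) => [|k1 d' _ _ _ dt _|k1 act]; first by rewrite sk.
    by left; move: dd; rewrite dt inE => /eqP ->; rewrite /= eqxx.
  by left; rewrite (active_dissemination act).
have [sk dt] := IH lt; have := epoch_mono i (ltnW lt); rewrite ek0 => le_e.
have [->//|[a [_ E ena ->]]] := stateP k i.
rewrite /step_effect; case: a E ena => [|d|e'|j [e' s|e' [s|]]|d] E /= ena.
- by rewrite sk in ena.
- by case: ifP.
- case/and3P: ena => _ le_e' _; split=> //; right.
  by rewrite ltnS (leq_trans le_e).
- by case: ifP.
- by case: ifP => //= /andP[lt_e' _]; split=> //; right; apply: leq_ltn_trans lt_e'.
- by [].
- by split=> //; case: dt => [->|]; [left|right].
Qed.

Lemma entry_ltn k1 k2 i e1 e2 : entry k1 i e1 -> entry k2 i e2 -> (k1 < k2)%N ->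
  (e1 < e2)%N.
Proof.
move=> en1 [<- [a E ea]] lt; have [sk dt] := entry_after en1 lt.
have [_] := step_enabled ex E; case: a E ea => // [|d] E _ /=; first by rewrite sk.
by case/and3P=> _ dd _; case: dt => // dt; rewrite dt in dd.
Qed.

Lemma entry_inj k1 k2 i e : entry k1 i e -> entry k2 i e -> k1 = k2.
Proof.
move=> en1 en2; case: (ltngtP k1 k2) => // lt.
  by have := entry_ltn en1 en2 lt; rewrite ltnn.
by have := entry_ltn en2 en1 lt; rewrite ltnn.
Qed.

(** * Unforgeability: where a new epoch comes from *)

Lemma quorum_correct (Q : {set proc f}) : (2 * f + 1 <= #|Q|)%N -> (0 < f)%N ->
  exists2 j, j \in Q & j \in correct al.
Proof.
move=> Qf f0; have [/existsP[j /andP[]]|] :=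
  boolP [exists j, (j \in Q) && (j \in correct al)].
  by exists j.
rewrite negb_exists => /forallP no.
have /subset_leq_card : Q \subset (~: correct al)%SET.
  by apply/fintype.subsetP => j jQ; rewrite inE; have := no j; rewrite jQ.
by have := few_byzantine ex; lia.
Qed.

Lemma completed_sent k i e j : j \in completed (st k i) e -> j \in correct al ->
  exists2 k', (k' < k)%N & sends k' j (EpochCompleted e (PSig j e)).
Proof.
move=> jc jcor; elim: k jc => [|k IH]; first by rewrite inE.
have weak : j \in completed (st k i) e ->
    exists2 k', (k' < k.+1)%N & sends k' j (EpochCompleted e (PSig j e)).
  by move=> /IH[k' lt sk']; exists k' => //; exact: ltnW.
have [->//|[a [_ E _ ->]]] := stateP k i.
rewrite /step_effect; case: a E => [|d|e'|j' [e' [j'' e'']|e' [s|]]|d] E //=.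
- by case: ifP.
- case: ifP => //= /andP[/eqP jj /eqP ee]; case: eqP => // eE.
  rewrite in_setU1 => /orP[/eqP jE|//]; have := links_authenticated ex E.
  move: jcor; rewrite jE -jj eE -ee => -> [k' [lt sk']].
  by exists k' => //; exact: ltnW.
- by case: ifP.
Qed.

(** Correct processes send only their own partial signatures, so that of a correct [j] becomes known
    only through a completion by [j]. *)
Lemma psig_completed k e j : psig_known delta Delta eps al k (PSig j e) ->
  j \in correct al ->
  exists2 k', (k' < k)%N & sends k' j (EpochCompleted e (PSig j e)).
Proof.
case=> /= [/negP//|[k' [j' [e' [lt _ se]]]] _].
have [ek sE _] := sends_completed se; case: sE se => <- <- se.
by exists k'.
Qed.

(** A new epoch rests on a quorum, which contains a correct process that completed the preceding
    epoch, or on a threshold signature sent by a correct process already in the new epoch. *)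
Lemma epoch_raise k i : (0 < f)%N -> (epoch (st k i) < epoch (st k.+1 i))%N ->
  exists k' j, [/\ (k' < k)%N, j \in correct al &
    epoch (st k' j) = epoch (st k.+1 i) \/
    exists2 e, epoch (st k.+1 i) = e.+1 &
               sends k' j (EpochCompleted e (PSig j e))].
Proof.
move=> f0; have [->|[a [ic E en ->]]] := stateP k i; first by rewrite ltnn.
move: en; rewrite /step_effect.
case: a E => [|d|e|j [e s|e [[s]|]]|d] E /=; rewrite ?ltnn //.
- by case: ifP; rewrite ltnn.
- case/and3P=> _ _ /quorum_correct -/(_ f0)[j jQ jc] _.
  have [k' lt sk'] := completed_sent jQ jc.
  by exists k', j; split=> //; right; exists e.
- by case: ifP; rewrite ltnn.
- move=> _; case: ifP => /=; last by rewrite ltnn.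
  case/andP=> lt_e /eqP eE _; have := links_authenticated ex E.
  case: ifP => [jc [k' [lt se]]|_].
    have [ek _ _] := sends_enter se; exists k', j; split=> //; by left.
  case=> [[Q [Qf Qk]]|[k' [j' [e' [lt jc se]]]]].
    have [j' jQ jc] := quorum_correct Qf f0.
    have [k' lt sk'] := psig_completed (Qk j' jQ) jc.
    by exists k', j'; split=> //; right; exists s.
  have [ek /esym/epoch_sig_epoch sE _] := sends_enter se.
  by exists k', j'; split=> //; left; rewrite sE.
Qed.

(** Strong induction on the step: trace the raise beyond [e] to its cause. Either that is a
    completion of [e], or the correct process behind it was itself already beyond [e] at an earlier
    step. *)
Lemma epoch_completed k i e : (0 < f)%N -> (0 < e)%N -> (e < epoch (st k i))%N ->
  exists k' j, [/\ (k' < k)%N, j \in correct al &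
                   sends k' j (EpochCompleted e (PSig j e))].
Proof.
move=> f0 e0; elim/ltn_ind: k i => -[|k] IH i lt_e; first by move: lt_e e0 => /=; lia.
have IHlt k1 j : (k1 <= k)%N -> (e < epoch (st k1 j))%N ->
    exists k' j, [/\ (k' < k.+1)%N, j \in correct al &
                     sends k' j (EpochCompleted e (PSig j e))].
  move=> k1k /(IH k1 k1k)[k' [j' [lt jc se]]]; exists k', j'; split=> //.
  by rewrite (leq_trans lt) // ltnW.
have [le_e|] := leqP (epoch (st k i)) e; last exact: IHlt.
have [k' [j [lt jc [ek|[e' eE se]]]]] := epoch_raise f0 (leq_ltn_trans le_e lt_e).
  by apply: (IHlt k' j); [exact: ltnW|rewrite ek].
move: lt_e; rewrite eE ltnS leq_eqVlt => /orP[/eqP eE'|lt_e].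
  by exists k', j; split=> //; [exact: ltnW|rewrite eE'].
have [ek _ _] := sends_completed se.
by apply: (IHlt k' j); [exact: ltnW|rewrite ek].
Qed.

(** * Reception of messages *)

Lemma completed_step k i e j :
  j \in completed (st k i) e -> j \in completed (st k.+1 i) e.
Proof.
have [->//|[a [_ _ _ ->]]] := stateP k i.
rewrite /step_effect; case: a => [|d|e'|j' [e' s|e' [s|]]|d] //=.
- by case: ifP.
- by case: ifP => //= _; case: eqP => // _; rewrite in_setU1 orbC => ->.
- by case: ifP.
Qed.

Lemma received_completed k l i j e :
  event al k = Some (i, Receive j (EpochCompleted e (PSig j e))) -> (k < l)%N ->
  j \in completed (st l i) e.
Proof.
move=> E /subnK <-; elim: (l - k.+1)%N => [|m]; last exact: completed_step.
by rewrite add0n (state_step E) /step_effect /= !eqxx /= eqxx in_setU1 eqxx.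
Qed.

Lemma received_epoch k l i j e : (0 < e)%N ->
  event al k = Some (i, Receive j (EnterEpoch f e (Some (TSig e.-1)))) ->
  (k < l)%N -> (e <= epoch (st l i))%N.
Proof.
move=> e0 E kl; apply: leq_trans (epoch_mono i kl).
rewrite (state_step E) /step_effect /= prednK // eqxx andbT.
by case: ltnP.
Qed.

(** * Entries: origin, timing and spreading *)

Lemma enters_entry k i v : enters k i v ->
  exists k0 j, [/\ entry k0 i (epoch (st k i)), after (tm k0) (j.-1%:R * vd) (tm k),
    v = global_view f (epoch (st k i)) j & (0 < j)%N].
Proof.
case=> a [E]; have [ic en] := step_enabled ex E.
have here : is_entry a -> [/\ entry k i (epoch (st k i)),
    after (tm k) (1%N.-1%:R * vd) (tm k) & (0 < 1)%N].
  by move=> ea; split=> //; [split=> //; exists a|rewrite mul0r; apply: after_refl].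
rewrite /step_effect; case: a E en here => [|d|e|j [e s|e [s|]]|d] E en here //=.
- have [? ? ?] := here isT; case=> <-; exists k, 1%N; split=> //.
  by move: en => /= /not_started ->.
- case: ifP => // _ [<-]; have /and3P[sk dv dk] := en.
  case: (state_phase k ic) => [|k0 d' _ _ vt|k0 act]; first by rewrite sk.
    by rewrite vt in dv.
  have [lt en0 _ _ _ tim] := act.
  exists k0, (view (st k i)).+1; split=> //.
  case: tim => [[d' vt aft]|[vt _ _]]; last by rewrite vt in dv.
  have dd' : d = d' by apply/eqP; move: dv; rewrite vt inE.
  apply: (after_expire ic (time_monotone ex (ltnW lt)) _ _ dk).
  + by rewrite mulr_ge0 // ltW // vd_gt0.
  + by rewrite mem_cat dv.
  + by rewrite dd'.
- by case: ifP.
- by case: ifP.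
- by have [? ? ?] := here isT; case=> <-; exists k, 1%N.
Qed.

(** Without a change of epoch since [t], the only dissemination that may be pending at [t] is over
    by [t + delta]. *)
Lemma settled i t u : i \in correct al -> G <= t -> t + delta <= u ->
  (epoch (st (idx u) i) <= epoch (st (idx t) i))%N ->
  exists2 k0, active (idx u) k0 i (st (idx u) i) & tm k0 <= t + delta.
Proof.
move=> ic Gt tu eut; have d0 := delta_gt0.
have act v : t + delta <= v -> (epoch (st (idx v) i) <= epoch (st (idx t) i))%N ->
    exists k0, active (idx v) k0 i (st (idx v) i).
  move=> tv ev.
  case: (state_phase (idx v) ic) => [|k0 d lt_e _ _ dt [up _]|k0]; last by exists k0.
    by rewrite started_idx //; lra.
  (* The epoch has not risen since [t], so this dissemination began by [t] and is due by
     [t + delta]. *)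
  have : tm k0 <= t by rewrite -ltn_idx (epoch_ltn (leq_trans lt_e ev)).
  move=> /up /(_ Gt) dd; have : v < due i d.
    by apply: pending_idx => //; [lra|rewrite mem_cat dt inE eqxx orbT].
  lra.
have tt : t <= t + delta by lra.
have le1 := epoch_mono i (idx_mono tt); have le2 := epoch_mono i (idx_mono tu).
have [k0 act0] := act _ (lexx _) (leq_trans le2 eut).
have [k1 act1] := act _ tu eut; exists k1 => //.
(* Entries into one epoch are unique: the one behind the state at [u] was already made by
   [t + delta]. *)
rewrite -ltn_idx -(@entry_inj k0 k1 i (epoch (st (idx u) i))).
- exact: active_lt act0.
- have -> : epoch (st (idx u) i) = epoch (st (idx (t + delta)) i) by lia.
  exact: active_entry act0.
- exact: active_entry act1.
Qed.

(** Either [i] is still in [e] at [t + delta] and has entered it, or it has passed [e], and then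
    some correct process completed [e] and so entered it before. *)
Lemma entry_by i t e : (0 < f)%N -> i \in correct al -> G <= t -> (0 < e)%N ->
  (e <= epoch (st (idx t) i))%N -> exists k j, entry k j e /\ tm k <= t + delta.
Proof.
move=> f0 ic Gt e0 et; have d0 := delta_gt0.
have tt : t <= t + delta by lra.
have [le_e|lt_e] := leqP (epoch (st (idx (t + delta)) i)) e.
  have [k0 act k0t] := settled ic Gt (lexx _) (leq_trans le_e et).
  exists k0, i; split=> //; have := active_entry act.
  suff -> : epoch (st (idx (t + delta)) i) = e by [].
  by have := epoch_mono i (idx_mono tt); lia.
have [k [j [lt _ /completion_entry[k0 [lt0 en _]]]]] := epoch_completed f0 e0 lt_e.
by exists k0, j; split=> //; rewrite -ltn_idx (ltn_trans lt0).
Qed.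

(** The entry is announced to all, and the announcement arrives within [delta] of the later of the
    entry and GST; epoch 1 needs no announcement. *)
Lemma spread k j e t i : entry k j e -> i \in correct al ->
  G + delta <= t -> tm k + delta <= t -> (e <= epoch (st (idx t) i))%N.
Proof.
move=> en ic Gt kt; have [e1|e1] := leqP e 1; first exact: leq_trans e1 (epoch_gt0 _ _).
have [k' [_ E k't]] := links_reliable ex ic (entry_correct en) (entry_sends en e1).
apply: (received_epoch (ltnW e1) E); rewrite ltn_idx (le_trans k't) //.
by case: (leP (tm k) G).
Qed.

(** * The first entry into a new epoch after GST *)

Lemma card_correct : (2 * f + 1 <= #|correct al|)%N.
Proof.
have := few_byzantine ex; have := cardsC (correct al).
by rewrite card_ord /nproc; lia.
Qed.

(* [e] is the highest epoch reached by GST. *)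
Lemma fresh_epoch : (0 < f)%N -> exists e ts,
  [/\ G <= ts <= G + 5 * delta + f.+1%:R * vd,
      exists k j, entry k j e.+1 /\ tm k = ts,
      forall k i, entry k i e.+1 -> ts <= tm k &
      forall i, i \in correct al -> (e <= epoch (st (idx (G + 2 * delta)) i))%N].
Proof.
move=> f0; have d0 := delta_gt0; have vd0 := vd_gt0.
have [|p pc Mp] := @eq_bigmax_cond _ (mem (correct al)) (fun i => epoch (st (idx G) i)).
  by apply: leq_trans card_correct; rewrite addn1.
set M := \max_(i in correct al) epoch (st (idx G) i) in Mp.
have leM i : i \in correct al -> (epoch (st (idx G) i) <= M)%N.
  by move=> ic; rewrite /M (@leq_bigmax_cond _ _ (fun i => epoch (st (idx G) i))).
have M0 : (0 < M)%N by rewrite Mp epoch_gt0.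
have f1 : 0 <= f.+1%:R * vd by rewrite mulr_ge0 // ltW.
have caught i : i \in correct al -> (M <= epoch (st (idx (G + 2 * delta)) i))%N.
  have [k [j [en kG]]] : exists k j, entry k j M /\ tm k <= G + delta.
    by apply: (@entry_by p) => //; rewrite Mp.
  by move=> ic; apply: (spread en ic); lra.
(* Two [delta] to catch up with [M], one for dissemination, then all [f.+1] views. *)
pose T := G + 3 * delta + f.+1%:R * vd.
have completes i : i \in correct al -> (epoch (st (idx (T + delta)) i) <= M)%N ->
    exists2 k, tm k <= T & sends k i (EpochCompleted M (PSig i M)).
  move=> ic leT; have TT : T <= T + delta by lra.
  have leT' := leq_trans (epoch_mono i (idx_mono TT)) leT.
  have GT : G + 2 * delta <= T by rewrite /T; lra.
  have MT := epoch_mono i (idx_mono GT); have cau := caught i ic.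
  have [| | |k0 act k0t] := @settled i (G + 2 * delta) T ic;
    [lra|rewrite /T; lra|exact: leq_trans leT' cau|].
  have [lt en dt vw _ [[d vt [up _]]|[_ _ [k [kT se _]]]]] := act; last first.
    have ME : epoch (st (idx T) i) = M.
      by apply/eqP; rewrite eqn_leq leT' (leq_trans cau).
    by exists k; [rewrite -ltn_idx|rewrite -ME].
  have k0t' : tm k0 <= G + 3 * delta by lra.
  have : due i d <= T.
    apply: le_trans (up _ k0t' _) _; first by lra.
    by rewrite /T lerD2l ler_pM2r // ler_nat; case/andP: vw.
  rewrite leNgt pending_idx //; first by rewrite /T; lra.
  by rewrite mem_cat vt inE eqxx.
(* If nobody had left [M] by [T + delta], the completions of all correct processes would have
   reached [p], and its quorum handler would be enabled, against urgency. *)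
have [i ic Mi] : exists2 i, i \in correct al & (M < epoch (st (idx (T + delta)) i))%N.
  have [/existsP[i /andP[]]|] :=
    boolP [exists i, (i \in correct al) && (M < epoch (st (idx (T + delta)) i))%N].
    by exists i.
  rewrite negb_exists => /forallP no.
  have no' i : i \in correct al -> (epoch (st (idx (T + delta)) i) <= M)%N.
    by move=> ic; have := no i; rewrite ic /= -leqNgt.
  have GT : G <= T + delta by rewrite /T; lra.
  have := @quiescent p (T + delta) (Quorum M) pc GT isT.
  rewrite /= started_idx // no' //= => /negP[]; apply: leq_trans card_correct _.
  apply/subset_leq_card/fintype.subsetP => i ic.
  have [k kT se] := completes i ic (no' i ic).
  have [k' [_ E k't]] := links_reliable ex pc ic se.
  apply: (received_completed E); rewrite ltn_idx (le_trans k't) // lerD2r.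
  by rewrite ge_max kT /T /=; lra.
have [k [j [en kT]]] := @entry_by i (T + delta) M.+1 f0 ic ltac:(rewrite /T; lra) isT Mi.
(* The entry of least index is also earliest in time. It comes after GST, since no correct process
   is beyond [M] at GST. *)
have exk : exists k, `[< exists j, entry k j M.+1 >] by exists k; apply/asboolP; exists j.
case: (ex_minnP exk) => k1 /asboolP[j1 en1] min1.
exists M, (tm k1); split=> //.
- apply/andP; split.
    rewrite leNgt; apply/negP => /ltW; rewrite -ltn_idx => /ltnW /(epoch_mono j1).
    by have [-> _] := en1; have := leM _ (entry_correct en1); lia.
  have : tm k1 <= tm k by apply: (time_monotone ex); apply: min1; apply/asboolP; exists j.
  by move: kT; rewrite /T; lra.
- by exists k1, j1.
- by move=> k2 i2 en2; apply: (time_monotone ex); apply: min1; apply/asboolP; exists i2.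
Qed.

(** * Overlap of the views in the new epoch *)

(** Passing [e] takes a completion of [e], which comes [f.+1] view durations after an entry and
    hence not before the stated time. *)
Lemma epoch_bound e ts t i : (0 < f)%N -> (0 < e)%N -> G <= ts ->
  (forall k j, entry k j e -> ts <= tm k) -> t < ts + f.+1%:R * vd ->
  (epoch (st (idx t) i) <= e)%N.
Proof.
move=> f0 e0 Gts first lt_t; rewrite leqNgt; apply/negP.
move=> /(epoch_completed f0 e0)[k [j [lt _ /completion_entry[k0 [_ en [_ lo]]]]]].
have tk := first _ _ en; have := lo (le_trans Gts tk).
by move: lt; rewrite ltn_idx => kt; lra.
Qed.

(** The [f.+1] views of an epoch have distinct leaders, because [f.+1] is at most the number of
    processes; at most [f] of them are Byzantine. *)
Lemma correct_leader e : exists2 j, (0 < j <= f.+1)%N &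
  leader f (global_view f e j) \in correct al.
Proof.
pose l (j : 'I_f.+1) := leader f (global_view f e j.+1).
have [/existsP[j jc]|] := boolP [exists j, l j \in correct al].
  by exists j.+1 => //; exact: ltn_ord.
rewrite negb_exists => /forallP no.
have l_inj : injective l.
  move=> j j' /(congr1 val) /eqP /=; rewrite /global_view !addnS -!addSn eqn_modDl.
  have lt_n (m : 'I_f.+1) : (m < (3 * f).+1)%N by have := ltn_ord m; lia.
  by rewrite !modn_small // => /eqP/val_inj.
have /subset_leq_card : [set l j | j in 'I_f.+1]%SET \subset (~: correct al)%SET.
  by apply/fintype.subsetP => _ /imsetP[j _ ->]; rewrite inE no.
by rewrite card_imset // card_ord; have := few_byzantine ex; lia.
Qed.

(** Process [i] enters [e] between [ts] and [ts + 2 * delta], and from then on its views have exact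
    length. So the [j]-th view has begun by the lower bound on [t] and does not end before the upper
    bound. *)
Lemma in_view_of_epoch e ts i j t : (0 < f)%N -> (0 < e)%N -> G <= ts ->
  (exists k p, entry k p e /\ tm k = ts) ->
  (forall k p, entry k p e -> ts <= tm k) ->
  i \in correct al -> (0 < j <= f.+1)%N ->
  ts + 2 * delta + j.-1%:R * vd <= t -> t < ts + j%:R * vd ->
  in_view delta Delta eps al i (global_view f e j) t.
Proof.
move=> f0 e0 Gts [k [p [enp kts]]] first ic /andP[j0 jf] lo hi.
have d0 := delta_gt0; have vd0 := vd_gt0.
have j1 : 0 <= j.-1%:R * vd by rewrite mulr_ge0 // ltW.
have et : (epoch (st (idx t) i) <= e)%N.
  apply: epoch_bound first _ => //; apply: lt_le_trans hi _.
  by rewrite lerD2l ler_pM2r // ler_nat.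
have te : (e <= epoch (st (idx (ts + delta)) i))%N.
  by apply: (spread enp ic); rewrite ?kts //; lra.
have [| |k0 act k0t] := settled ic _ _ (leq_trans et te); [lra|lra|].
have eE : epoch (st (idx t) i) = e.
  apply/eqP; rewrite eqn_leq et (leq_trans te) //; apply/epoch_mono/idx_mono; lra.
have [lt en dt vw ents tim] := act; rewrite eE in en ents.
have Gk0 : G <= tm k0 := le_trans Gts (first _ _ en).
(* In a lower view, the pending timer would already have been due by [t]. *)
have jv : (j <= view (st (idx t) i))%N.
  case: tim => [[d vt [up _]]|[_ -> _] //].
  have : t < due i d by apply: pending_idx => //; [lra|rewrite mem_cat vt inE eqxx].
  have dv := up _ (lexx _) Gk0; rewrite -(prednK j0) -(ltr_nat R) -(ltr_pM2r vd0).
  by lra.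
have [|k' [k0k' k't ent [up low]]] := ents j; first by rewrite j0.
have k'E : tm k' = tm k0 + j.-1%:R * vd.
  by apply/eqP; rewrite eq_le (up _ (lexx _) Gk0) low.
exists k'; split=> //; first by rewrite -ltn_idx.
(* Another view entered by [t] would stem from the same epoch entry, and its time forces its index
   to be [j]. *)
move=> l v' k'l entl vv'; rewrite ltNge; apply/negP; rewrite -ltn_idx => lt_l.
have [k1 [j' [en1 [up1 low1] v'E j'0]]] := enters_entry entl.
have lE : epoch (st l i) = e.
  apply/eqP; rewrite eqn_leq; apply/andP; split.
    by rewrite -eE epoch_mono // ltnW.
  by have [<- _] := en; rewrite epoch_mono // (leq_trans k0k') // ltnW.
rewrite lE in en1 v'E; have k01 := entry_inj en1 en; subst k1.
have lt_l' : tm l < tm k0 + j%:R * vd.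
  rewrite ltn_idx in lt_l; apply: le_lt_trans lt_l _; apply: lt_le_trans hi _.
  by rewrite lerD2r; exact: first en.
have j'j : (j'.-1 <= j.-1)%N.
  by rewrite -ltnS (prednK j0) -(ltr_nat R) -(ltr_pM2r vd0); have := low1 Gk0; lra.
have jj' : (j.-1 <= j'.-1)%N.
  rewrite -(ler_nat R) -(ler_pM2r vd0); have := up1 _ (lexx _) Gk0.
  by have := time_monotone ex (ltnW k'l); lra.
have jE' : j'.-1 = j.-1 by apply/eqP; rewrite eqn_leq j'j jj'.
by apply: vv'; rewrite v'E -(prednK j'0) jE' (prednK j0).
Qed.

(** The common stretch of a view lasts [vd - 2 * delta], which exceeds [Delta]; the view taken is
    one with a correct leader. *)
Lemma synchronized e ts : (0 < f)%N -> (0 < e)%N -> G <= ts ->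
  (exists k i, entry k i e /\ tm k = ts) ->
  (forall k i, entry k i e -> ts <= tm k) ->
  exists u, [/\ ts <= u, synchronization_time delta Delta eps al u &
                u + Delta < ts + f.+1%:R * vd].
Proof.
move=> f0 e0 Gts enp first; have vd0 := vd_gt0; have vdD := vd_gt.
have d0 := delta_gt0; have [j /andP[j0 jf] lc] := correct_leader e.
have j1 : 0 <= j.-1%:R * vd by rewrite mulr_ge0 // ltW.
have lt_end : ts + 2 * delta + j.-1%:R * vd + Delta < ts + j%:R * vd.
  by rewrite -[j in ltRHS]prednK // mulrSr mulrDl mul1r; lra.
exists (ts + 2 * delta + j.-1%:R * vd); split; first by lra.
  exists (global_view f e j); split=> // i t ic lo hi.
  apply: in_view_of_epoch first ic _ lo _ => //; first by rewrite j0.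
  exact: le_lt_trans hi lt_end.
by apply: lt_le_trans lt_end _; rewrite lerD2l ler_pM2r // ler_nat.
Qed.


(** * Counting broadcasts after GST *)

(** A completion consumes the last pending expiration, and only a new epoch starts a timer again; so
    each epoch is completed at most once. *)
Lemma completion_after k0 k i e s : sends k0 i (EpochCompleted e s) -> (k0 < k)%N ->
  started (st k i) /\ (pending (st k i) = [::] \/ (e < epoch (st k i))%N).
Proof.
move=> se; have [k1 act _] := completion_active se.
have [ek0 _ [d [E dv dk vf]]] := sends_completed se.
have [ic /and3P[sk0 _ _]] := step_enabled ex E.
elim: k => // k IH; rewrite ltnS leq_eqVlt => /orP[/eqP kE|lt].
  subst k; rewrite (state_step E) /step_effect /= ltnNge vf /pending /=.
  split=> //; left; rewrite (active_dissemination act).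
  case: (active_timer act) => [[d' vt _]|[vt _ _]]; rewrite vt ?inE // in dv.
  by rewrite vt (eqP dv) /= eqxx.
have [sk pe] := IH lt; have := epoch_mono i (ltnW lt); rewrite ek0 => le_e.
have [->//|[a [_ E' ena ->]]] := stateP k i.
rewrite /step_effect; case: a E' ena => [|d'|e'|j [e' s'|e' [s'|]]|d'] E' /= ena.
- by rewrite sk in ena.
- case: pe => [pe|lt_e]; last by case: ifP; split=> //; right.
  by have /and3P[_ dv' _] := ena; move: pe; rewrite /pending; case: view_timer dv'.
- case/and3P: ena => _ le_e' _; split=> //; right.
  by rewrite ltnS (leq_trans le_e).
- by case: ifP.
- by case: ifP => //= /andP[lt_e' _]; split=> //; right; apply: leq_ltn_trans lt_e'.
- by [].
- split=> //; case: pe => [pe|]; last by right.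
  have /and3P[_ dd _] := ena; move: pe; rewrite /pending.
  by case: view_timer => //= dt; rewrite dt in dd.
Qed.

Definition is_completion (m : msg f) : bool :=
  if m is EpochCompleted _ _ then true else false.

(* Each broadcast waits for a timer started in the same epoch. *)
Lemma sends_spaced k1 k2 i m1 m2 : sends k1 i m1 -> sends k2 i m2 ->
  is_completion m1 = is_completion m2 -> (k1 < k2)%N -> G <= tm k1 ->
  (epoch (st k1 i) < epoch (st k2 i))%N /\ tm k1 + delta <= tm k2.
Proof.
have vd0 := vd_gt0; have vdd := vd_gt; have d0 := delta_gt0; have D0 := Delta_gt0.
case: m1 => [e1 s1|e1 s1] se1; case: m2 => [e2 s2|e2 s2] se2 //= _ lt Gk1.
  have [<- _ [d [E dv _ _]]] := sends_completed se1.
  have [ek2 _ [d2 [E2 dv2 _ _]]] := sends_completed se2.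
  have [_ [pe|lt_e]] := completion_after se1 lt.
    by move: pe; rewrite /pending; case: view_timer dv2.
  have [ek1 _ _] := sends_completed se1; rewrite ek1.
  (* The epoch of the second completion is entered after the first completion, and its views
     together take at least [vd]. *)
  split=> //; have [k0 [_ en [_ lo]]] := completion_entry se2.
  have k10 : (k1 < k0)%N.
    by apply: (@epoch_ltn _ _ i); have [-> _] := en; rewrite ek1 -ek2.
  have t10 := time_monotone ex (ltnW k10); have := lo (le_trans Gk1 t10).
  suff : vd <= f.+1%:R * vd by lra.
  by rewrite ler_peMl ?ler1n // ltW.
have [ek1 _ [d1 E1]] := sends_enter se1; have [ek2 _ [d2 E2]] := sends_enter se2.
have lt_e : (epoch (st k1 i) < epoch (st k2 i))%N.
  apply: (@entry_ltn k1 k2 i) => //; split=> //.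
    by exists (DisseminationExpire d1).
  by exists (DisseminationExpire d2).
split=> //; have [ic /and3P[sk dd dk]] := step_enabled ex E2.
case: (state_phase k2 ic) => [|k0 d _ ek0 _ dt [_ lo]|k0 act]; first by rewrite sk.
  (* The second dissemination timer was started when the epoch rose, which is after [k1]. *)
  have k10 : (k1.+1 < k0.+1)%N.
    by apply: (@epoch_ltn _ _ i); rewrite ek0 (state_step E1).
  have t10 := time_monotone ex (ltnW k10); have t12 := time_monotone ex (ltnW lt).
  have t10' := time_monotone ex (ltnW (k10 : (k1 < k0)%N)).
  have dE : d2 = d by apply/eqP; move: dd; rewrite dt inE.
  have := lo (le_trans Gk1 t10').
  by move: dk; rewrite dE le_clock // ?(le_trans Gk1) //; lra.
by rewrite (active_dissemination act) in dd.
Qed.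

Lemma step_wordsP k : step_words delta Delta eps al k = 0%N \/
  step_words delta Delta eps al k = nproc f /\ exists i m, sends k i m.
Proof.
rewrite /step_words; case E: (event al k) => [[i a]|]; last by left.
case B: (broadcasts _) => [m|]; last by left.
by right; split; [rewrite /words muln1|exists i, m, a].
Qed.

(* Together with its sender and its kind, the slot of a broadcast determines
   it: the epoch once that is at least [e], and before that the time since GST
   in units of [delta]. *)
Definition slot (e k : nat) (i : proc f) : nat :=
  if (epoch (st k i) < e)%N then Num.truncn ((tm k - G) / delta)
  else (3 + (epoch (st k i) - e))%N.

Lemma truncn_slot k : G <= tm k ->
  (Num.truncn ((tm k - G) / delta))%:R * delta <= tm k - G <
  (Num.truncn ((tm k - G) / delta)).+1%:R * delta.
Proof.
have d0 := delta_gt0; move=> Gk.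
rewrite -ler_pdivlMr // -ltr_pdivrMr //.
by apply: truncn_itv; rewrite divr_ge0 ?subr_ge0 // ltW.
Qed.

(** Broadcasts below epoch [e] fall within [2 * delta] after GST, hence in slots 0, 1 and 2; this is
    why later slots start at 3. *)
Lemma early_slot e k i : (e <= epoch (st (idx (G + 2 * delta)) i))%N ->
  (epoch (st k i) < e)%N -> G <= tm k -> (Num.truncn ((tm k - G) / delta) < 3)%N.
Proof.
move=> low lt_k Gk; have d0 := delta_gt0; have : tm k <= G + 2 * delta.
  by rewrite -ltn_idx; apply: epoch_ltn (leq_trans lt_k low).
have /andP[lo _] := truncn_slot Gk.
by move=> kG; rewrite ltnS -(ler_nat R) -(ler_pM2r d0); lra.
Qed.

Lemma slot_lt e k i : (e <= epoch (st (idx (G + 2 * delta)) i))%N ->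
  (epoch (st k i) <= e.+1)%N -> G <= tm k -> (slot e k i < 5)%N.
Proof.
move=> low high Gk; rewrite /slot; case: ifP => [lt_e|_].
  exact: (leq_trans (early_slot low lt_e Gk)).
by rewrite (ltn_add2l 3 _ 2) ltnS leq_subLR addn1.
Qed.

(** Two early broadcasts lie in different intervals of length [delta], two late ones in different
    epochs, and early slots are below 3. *)
Lemma slot_neq e k1 k2 i : (e <= epoch (st (idx (G + 2 * delta)) i))%N ->
  G <= tm k1 -> (epoch (st k1 i) < epoch (st k2 i))%N -> tm k1 + delta <= tm k2 ->
  slot e k1 i <> slot e k2 i.
Proof.
move=> low Gk1 lt_e le_t; have d0 := delta_gt0.
have Gk2 : G <= tm k2 by lra.
rewrite /slot; case: ltnP => e1; case: ltnP => e2.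
- have /andP[lo1 _] := truncn_slot Gk1; have /andP[_ hi2] := truncn_slot Gk2.
  by move=> tE; move: hi2; rewrite -tE mulrSr mulrDl mul1r; lra.
- by have := early_slot low e1 Gk1 => + tE; rewrite tE -ltn_subRL subnn.
- by have := leq_ltn_trans e1 (ltn_trans lt_e e2); rewrite ltnn.
- move/addnI => eE; move: lt_e.
  by rewrite -(subnK e1) -(subnK e2) eE ltnn.
Qed.

(** Sender, kind and slot identify a broadcast in the window. There are [nproc f * 2 * 5] such
    triples, and each broadcast costs [nproc f] words. *)
Lemma sum_words e W N :
  (forall i, i \in correct al -> (e <= epoch (st (idx (G + 2 * delta)) i))%N) ->
  (forall i, i \in correct al -> (epoch (st (idx W) i) <= e.+1)%N) ->
  (\sum_(0 <= k < N | (G <= tm k <= W)%R) step_words delta Delta eps al k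
     <= 10 * nproc f ^ 2)%N.
Proof.
move=> low high.
pose code (k : 'I_N) : proc f * bool * 'I_5 :=
  if event al k is Some (i, a) then
    (i, if broadcasts (step k i a) is Some m then is_completion m else false,
     inord (slot e k i))
  (* A default for steps without an event, which lie outside [S]. *)
  else (leader f 0, false, ord0).
pose S := [set k : 'I_N |
  (G <= tm k <= W) && (0 < step_words delta Delta eps al k)%N]%SET.
have SP (k : 'I_N) : k \in S -> exists i m, [/\ G <= tm k, i \in correct al,
    (slot e k i < 5)%N, sends k i m & code k = (i, is_completion m, inord (slot e k i))].
  rewrite inE => /andP[/andP[Gk kW]]; case: (step_wordsP k) => [->//|[_ [i [m sk]]] _].
  have [a [E B]] := sk; have [ic _] := step_enabled ex E.
  exists i, m; split=> //; last by rewrite /code E B.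
  apply: slot_lt => //; first exact: low.
  by apply: leq_trans (high i ic); apply/epoch_mono/ltnW; rewrite ltn_idx.
have code_lt (k1 k2 : 'I_N) : k1 \in S -> k2 \in S -> code k1 = code k2 -> ~~ (k1 < k2)%N.
  move=> /SP[i1 [m1 [Gk1 ic sl1 s1 ->]]] /SP[i2 [m2 [_ _ sl2 s2 ->]]] [i12 m12 sl].
  rewrite -{}i12 in s2 sl sl2; apply/negP => lt.
  have [lt_e le_t] := sends_spaced s1 s2 m12 lt Gk1.
  apply: (slot_neq (low i1 ic) Gk1 lt_e le_t).
  by move: sl => /(congr1 val); rewrite /= !inordK.
have code_inj : {in S &, injective code}.
  move=> k1 k2 S1 S2 eq12; apply: val_inj; apply/eqP; rewrite eqn_leq.
  by rewrite leqNgt code_lt // leqNgt code_lt.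
have cardS : (#|S| <= 10 * nproc f)%N.
  rewrite -(card_in_imset code_inj) (leq_trans (max_card _)) //.
  by rewrite !card_prod card_bool !card_ord -mulnA mulnC.
have -> : (\sum_(0 <= k < N | (G <= tm k <= W)%R) step_words delta Delta eps al k
    = \sum_(k in S) step_words delta Delta eps al k)%N.
  rewrite big_mkord big_mkcond [RHS]big_mkcond; apply: eq_bigr => k _.
  by rewrite inE; case: ifP => //= _; case: step_words.
apply: (@leq_trans (\sum_(k in S) nproc f)).
  by apply: leq_sum => k _; case: (step_wordsP k) => [|[]] ->.
by rewrite sum_nat_const -mulnn mulnA leq_mul2r cardS orbT.
Qed.

(** * Bounds for one execution and for the protocol *)

Lemma execution_bounds : (0 < f)%N ->
  [/\ exists u, G <= u /\ synchronization_time delta Delta eps al u,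
      (exec_communication delta Delta eps al <= (10 * (nproc f)%:R ^+ 2)%:E)%E &
      (exec_latency delta Delta eps al <= ((5 * delta + 4 * vd) * f%:R)%:E)%E].
Proof.
move=> f0; have d0 := delta_gt0; have vd0 := vd_gt0.
have [e [ts [/andP[Gts ts_le] ent first low]]] := fresh_epoch f0.
have [u [tsu sync_u u_lt]] := synchronized f0 (ltn0Sn e) Gts ent first.
have first_le : first_sync_time delta Delta eps al <= u.
  (* A first synchronization time is at most [u] by minimality, and so is the default, which is
     GST. *)
  rewrite /first_sync_time; case: xgetP => [t _ [_ _ min_t]|_].
    by apply: min_t => //; apply: le_trans tsu.
  exact: le_trans tsu.
split; first by exists u; split=> //; apply: le_trans tsu.
  apply: lime_le.
    by apply: is_cvg_nneseries_cond => k _ _; rewrite lee_fin.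
  apply: nearW => N; rewrite sumEFin lee_fin -natr_sum -natrX -natrM ler_nat.
  apply: (@sum_words e (first_sync_time delta Delta eps al + Delta)) => // i _.
  by apply: (@epoch_bound e.+1 ts) => //; lra.
(* The latency is below [5 * delta + 2 * f.+1 * vd]: one term [f.+1 * vd] to reach the new epoch,
   one within it. As [f] is at least 1, [f.+1] is at most [2 * f]. *)
rewrite /exec_latency lee_fin.
have f1 : 1 <= f%:R :> R by rewrite ler1n.
have fd : delta <= delta * f%:R by rewrite ler_peMr // ltW.
have fv : vd <= vd * f%:R by rewrite ler_peMr // ltW.
by move: ts_le u_lt; rewrite -addn1 natrD; lra.
Qed.

End Execution.

Theorem theorem2 (R : realType) (delta Delta eps : R)
    (delta_gt0 : (0 < delta)%R) (Delta_gt0 : (0 < Delta)%R)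
    (eps_gt0 : (0 < eps)%R) :
  [/\ forall f : nat, (0 < f)%N ->
        forall al : trace R f, execution delta Delta eps al ->
          exists ts : R, (GST al <= ts)%R /\
            synchronization_time delta Delta eps al ts,
      exists C : R, forall f : nat, (0 < f)%N ->
        (communication_complexity delta Delta eps f
           <= (C * (nproc f)%:R ^+ 2)%R%:E)%E
    & exists C : R, forall f : nat, (0 < f)%N ->
        (latency_complexity delta Delta eps f <= (C * f%:R)%R%:E)%E ].
Proof.
split.
- move=> f f0 al ex.
  by have [] := execution_bounds delta_gt0 Delta_gt0 eps_gt0 ex f0.
- exists 10 => f f0; apply: ge_ereal_sup => _ [al ex <-].
  by have [] := execution_bounds delta_gt0 Delta_gt0 eps_gt0 ex f0.
- exists (5 * delta + 4 * view_duration delta Delta eps) => f f0.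
  apply: ge_ereal_sup => _ [al ex <-].
  by have [] := execution_bounds delta_gt0 Delta_gt0 eps_gt0 ex f0.
Qed.
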